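(* Let $g \ge 3$ be an integer. Let $\mathcal{A}_g$ denote the moduli space of principally polarized abelian varieties of complex dimension $g$, and let $\mathcal{A}_g^{\mathbb{Z}_2} \subset \mathcal{A}_g$ be the locus of isomorphism classes of principally polarized abelian varieties of dimension $g$ which admit an involution different from $-\mathrm{id}$. Then $\mathcal{A}_g^{\mathbb{Z}_2}$ is connected.
   Context: A ppav is a principally polarized abelian variety over $\mathbb{C}$; isomorphisms and automorphisms of ppavs are isomorphisms of the underlying complex tori preserving the principal polarizations. An involution of a ppav is an automorphism (as ppav) of order exactly two. Let $\mathscr{H}_g=\{ Z \in \mathrm{M}(g, \mathbb{C}) : Z = {}^tZ,\ \mathrm{Im}(Z) >0\}$ be the Siegel upper half space, $J=\begin{pmatrix}0&I_g\\-I_g&0\end{pmatrix}$, and $\mathrm{Sp}(2g,\mathbb{Z})=\{R\in \mathrm{M}(2g,\mathbb{Z}) : {}^tRJR=J\}$. The group $\mathrm{Sp}(2g,\mathbb{Z})$ acts on $\mathscr{H}_g$ by $\left(R=\begin{pmatrix}A&B\\C&D\end{pmatrix},Z\right)\mapsto (A+ZC)^{-1}(B+ZD)$. Each $Z\in\mathscr{H}_g$ represents the ppav with period matrix $(I_g\ Z)$, i.e. $\mathbb{C}^g/(\mathbb{Z}^g+Z\mathbb{Z}^g)$ with the polarization having matrix $J$ in the basis given by the columns of $(I_g\ Z)$. Then $\mathcal{A}_g=\mathscr{H}_g/\mathrm{Sp}(2g,\mathbb{Z})$, with its structure of complex analytic space (quotient topology), and $\mathcal{A}_g^{\mathbb{Z}_2}$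 carries the subspace topology. *)

(* Defs.v *)
From HB Require Import structures.
From mathcomp Require Import all_boot all_order all_algebra.
From mathcomp Require Import all_classical all_reals all_analysis.
From mathcomp Require Import complex.

Set Implicit Arguments.
Unset Strict Implicit.
Unset Printing Implicit Defensive.

Import Order.TTheory GRing.Theory Num.Theory numFieldNormedType.Exports.

Local Open Scope classical_set_scope.
Local Open Scope ring_scope.
Local Open Scope complex_scope.
Local Open Scope quotient_scope.

(* The analysis library topologizes an abstract numFieldType by its norm, but
   the instance is keyed on the structure and is not found from the head
   constant [complex]; this makes the same instance available on [R[i]]. *)
HB.instance Definition _ (R : realType) :=
  NormedModule.copy R[i] (R[i] : numClosedFieldType)^o.

(* The columns of [period Z] are e_1, ..., e_g, Z e_1, ..., Z e_g. *)
Definition period (K : pzRingType) (g : nat) (Z : 'M[K]_g) : 'M[K]_(g, g + g) :=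
  row_mx 1%:M Z.

Definition Jmx (K : pzRingType) (g : nat) : 'M[K]_(g + g) :=
  block_mx 0 1%:M (- 1%:M) 0.

Definition Sp (g : nat) : set 'M[int]_(g + g) :=
  [set M | M^T *m Jmx int g *m M = Jmx int g].

Section Siegel.
Variables (R : realType) (g : nat).
Implicit Types Z : 'M[R[i]]_g.

Definition posdef (Y : 'M[R]_g) : Prop :=
  forall v : 'cV[R]_g, v != 0 -> 0 < (v^T *m Y *m v) 0 0.

Definition ReM (m n : nat) (A : 'M[R[i]]_(m, n)) : 'M[R]_(m, n) :=
  map_mx (@complex.Re R) A.

Definition ImM (m n : nat) (A : 'M[R[i]]_(m, n)) : 'M[R]_(m, n) :=
  map_mx (@complex.Im R) A.

Definition siegel : set 'M[R[i]]_g := [set Z | Z^T = Z /\ posdef (ImM Z)].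

(* The right action of Sp(2g, Z) sending Z to (A + Z C)^-1 (B + Z D). *)
Definition Sp_act (M : 'M[int]_(g + g)) Z : 'M[R[i]]_g :=
  let N : 'M[R[i]]_(g + g) := map_mx intr M in
  invmx (ulsubmx N + Z *m dlsubmx N) *m (ursubmx N + Z *m drsubmx N).

Definition Sp_orbit (Z W : siegel) : bool :=
  `[< exists2 M, Sp M & val W = Sp_act M (val Z) >].

Lemma Jmx_sqr : Jmx int g *m Jmx int g = - 1%:M.
Proof.
rewrite /Jmx mulmx_block !(mulmx0, mul0mx, mulmxN, mulmx1, mul1mx, addr0, add0r).
by rewrite (scalar_mx_block g g) opp_block_mx oppr0.
Qed.

Lemma Sp_mulJT (M : 'M[int]_(g + g)) : Sp M -> M *m Jmx int g *m M^T = Jmx int g.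
Proof.
rewrite /Sp /= => SpM.
have /mulmx1C : (- (Jmx int g *m M^T *m Jmx int g)) *m M = 1%:M.
  by rewrite mulNmx -!mulmxA [M^T *m _]mulmxA SpM Jmx_sqr opprK.
rewrite mulmxN => /(congr1 (mulmxr (Jmx int g))) /=.
by rewrite mulNmx mul1mx -!mulmxA Jmx_sqr !mulmxN mulmx1 opprK mulmxA.
Qed.

Lemma Sp1 : @Sp g 1%:M.
Proof. by rewrite /Sp /= trmx1 mul1mx mulmx1. Qed.

Lemma Sp_mul (M N : 'M[int]_(g + g)) : Sp M -> Sp N -> Sp (M *m N).
Proof.
rewrite /Sp /= => SpM SpN.
by rewrite trmx_mul -!mulmxA (mulmxA M^T) (mulmxA (M^T *m _)) SpM mulmxA SpN.
Qed.

Lemma SpV (M : 'M[int]_(g + g)) : Sp M -> exists2 N, Sp N & M *m N = 1%:M.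
Proof.
move=> SpM; exists (- (Jmx int g *m M^T *m Jmx int g)); last first.
  by rewrite mulmxN !mulmxA Sp_mulJT // Jmx_sqr opprK.
have JT : (Jmx int g)^T = - Jmx int g.
  by rewrite /Jmx tr_block_mx !trmx0 linearN /= trmx1 opp_block_mx opprK oppr0.
have trN (A : 'M[int]_(g + g)) : (- A)^T = - A^T by apply/matrixP => i j; rewrite !mxE.
rewrite /Sp /= trN !trmx_mul trmxK JT.
rewrite !(mulNmx, mulmxN) !opprK -!mulmxA.
rewrite [Jmx int g *m (Jmx int g *m _)]mulmxA Jmx_sqr mulNmx mul1mx !mulmxN.
rewrite [M *m (Jmx int g *m _)]mulmxA [M *m _ *m _]mulmxA Sp_mulJT //.
by rewrite Jmx_sqr mulmxN mulmx1 opprK.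
Qed.

Lemma period_mul (Z : 'M[R[i]]_g) (N : 'M[R[i]]_(g + g)) :
  period Z *m N =
  row_mx (ulsubmx N + Z *m dlsubmx N) (ursubmx N + Z *m drsubmx N).
Proof. by rewrite -{1}(submxK N) /period mul_row_block !mul1mx. Qed.

Lemma posdef_complex (Y : 'M[R]_g) (w : 'rV[R[i]]_g) : posdef Y ->
  w *m map_mx (real_complex R) Y *m (map_mx conjc w)^T = 0 -> w = 0.
Proof.
move=> Ypos eq0.
pose q (v : 'rV[R]_g) := (v *m Y *m v^T) 0 0.
have q_gt0 v : v != 0 -> 0 < q v.
  by move=> v0; have := Ypos v^T; rewrite trmxK; apply; rewrite trmx_eq0.
have q_ge0 v : 0 <= q v.
  by have [->|/q_gt0/ltW//] := eqVneq v 0; rewrite /q !mul0mx mxE.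
have : q (ReM w) + q (ImM w) = 0.
  have /(congr1 (fun A : 'M[R[i]]_1 => complex.Re (A 0 0))) := eq0.
  rewrite [in RHS]mxE /= => <-; rewrite /q !mxE raddf_sum -big_split /=.
  apply: eq_bigr => j _; rewrite !mxE !mulr_suml raddf_sum -big_split /=.
  apply: eq_bigr => k _; rewrite !mxE.
  by case: (w 0 k) (w 0 j) => a b [c d] /=; simpc.
move/eqP; rewrite paddr_eq0 // => /andP[/eqP re0 /eqP im0].
have rew : ReM w = 0 by apply/eqP; apply: contraTT isT => /q_gt0; rewrite re0 ltxx.
have imw : ImM w = 0 by apply/eqP; apply: contraTT isT => /q_gt0; rewrite im0 ltxx.
apply/rowP => j; move/rowP/(_ j): rew; move/rowP/(_ j): imw; rewrite !mxE.
by case: (w 0 j) => a b /= -> ->.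
Qed.

Lemma Sp_act_unit (M : 'M[int]_(g + g)) (Z : 'M[R[i]]_g) : Sp M -> siegel Z ->
  let N : 'M[R[i]]_(g + g) := map_mx intr M in
  ulsubmx N + Z *m dlsubmx N \in unitmx.
Proof.
move=> SpM [Zsym Zpos] /=; set N : 'M[R[i]]_(g + g) := map_mx intr M; set P := _ + _.
rewrite -row_free_unit -kermx_eq0; apply/eqP/row_matrixP => k; rewrite row0.
set w := row k _; have wP : w *m P = 0.
  by apply/sub_kermxP; exact: row_sub.
pose J := Jmx R[i] g.
have NJ : N *m J *m (map_mx conjc N)^T = J.
  have -> : map_mx conjc N = N.
    by apply/matrixP => a b; rewrite !mxE rmorph_int.
  have JE : map_mx intr (Jmx int g) = J.
    by rewrite /J /Jmx map_block_mx !map_mx0 map_mxN map_mx1.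
  by rewrite -JE /N matrix.map_trmx -!map_mxM Sp_mulJT.
have conjP : map_mx conjc (period Z) = period (map_mx conjc Z).
  by rewrite /period map_row_mx map_mx1.
have : w *m period Z *m J *m (map_mx conjc (w *m period Z))^T = 0.
  rewrite -NJ.
  have -> : w *m period Z *m (N *m J *m (map_mx conjc N)^T) *m
      (map_mx conjc (w *m period Z))^T
    = (w *m period Z *m N) *m J *m (map_mx conjc (w *m period Z *m N))^T.
    by rewrite [in RHS]map_mxM trmx_mul !mulmxA.
  rewrite -(mulmxA w) period_mul mul_mx_row -/P wP /J /Jmx mul_row_block.
  rewrite !mul0mx !mulmx0 !add0r map_row_mx map_mx0 tr_row_mx mul_row_col.
  by rewrite trmx0 mulmx0 mul0mx addr0.
rewrite map_mxM trmx_mul conjP /period !mul_mx_row mulmx1 /J /Jmx.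
rewrite mul_row_block !mulmx0 !mulmx1 add0r addr0 mulmxN mulmx1.
rewrite tr_row_mx trmx1.
rewrite mulmxA mul_row_col mulmx1 matrix.map_trmx Zsym => eq0.
have subE : map_mx conjc Z - Z = (- (2 * 'i)) *: map_mx (real_complex R) (ImM Z).
  apply/matrixP => i j; rewrite !mxE; case: (Z i j) => a b.
  apply/eqP; rewrite eq_complex /= !(mulr0, mul0r, mulr1, addr0, subr0, oppr0).
  by rewrite !subrr eqxx /= add0r mulNr mulrDl mul1r opprD.
apply: (posdef_complex Zpos); apply/eqP.
have /eqP : - (2 * 'i) *: (w *m map_mx (real_complex R) (ImM Z) *m (map_mx conjc w)^T) = 0.
  rewrite scalemxAl scalemxAr -subE mulmxBr addrC; exact: eq0.
rewrite scaler_eq0 oppr_eq0 mulf_eq0 pnatr_eq0 /= => /orP[|//].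
by rewrite eq_complex /= oner_eq0 andbF.
Qed.

Lemma Sp_orbitE (Z W : siegel) :
  Sp_orbit Z W <-> exists M (P : 'M[R[i]]_g), [/\ Sp M, P \in unitmx &
    P *m period (val W) = period (val Z) *m map_mx intr M].
Proof.
split=> [/asboolP [M SpM WE]|[M [P [SpM Punit]]]].
  have Pu := Sp_act_unit SpM (set_valP Z).
  exists M; eexists; split; [exact: SpM | exact: Pu |].
  by rewrite period_mul /period mul_mx_row mulmx1 WE mulKVmx.
rewrite period_mul /period mul_mx_row mulmx1 => /eq_row_mx[PE PW].
by apply/asboolP; exists M => //; rewrite /Sp_act -PE -PW mulKmx.
Qed.

Lemma Sp_orbit_refl : reflexive Sp_orbit.
Proof.
move=> Z; apply/Sp_orbitE; exists 1%:M, 1%:M.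
by rewrite unitmx1 map_mx1 mulmx1 mul1mx; split=> //; exact: Sp1.
Qed.

Lemma Sp_orbit_sym : symmetric Sp_orbit.
Proof.
suff sym (Z W : siegel) : Sp_orbit Z W -> Sp_orbit W Z by move=> Z W; apply/idP/idP; exact: sym.
move=> /Sp_orbitE[M [P [SpM Pu PE]]]; have [N SpN MN] := SpV SpM.
apply/Sp_orbitE; exists N, (invmx P); rewrite unitmx_inv; split=> //.
rewrite -[period (val W)](mulKmx Pu) PE -!mulmxA -map_mxM MN map_mx1.
by rewrite mulmx1.
Qed.

Lemma Sp_orbit_trans : transitive Sp_orbit.
Proof.
move=> W Z V /Sp_orbitE[M [P [SpM Pu PE]]] /Sp_orbitE[N [Q [SpN Qu QE]]].
apply/Sp_orbitE; exists (M *m N), (P *m Q); rewrite unitmx_mul Pu Qu.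
split=> //; first exact: Sp_mul.
by rewrite -mulmxA QE mulmxA PE map_mxM mulmxA.
Qed.

Canonical Sp_orbit_equiv : equiv_rel siegel :=
  EquivRel Sp_orbit Sp_orbit_refl Sp_orbit_sym Sp_orbit_trans.

Definition moduli := quotient_topology {eq_quot Sp_orbit}.

(* [lattice Z] is the subgroup Z^g + Z Z^g of C^g. *)
Definition lattice Z : set 'cV[R[i]]_g :=
  [set u | exists m : 'cV[int]_(g + g), u = period Z *m map_mx intr m].

Definition lattice_eq Z (u v : 'cV[R[i]]_g) : bool := `[< lattice Z (u - v) >].

Lemma lattice_eq_refl Z : reflexive (lattice_eq Z).
Proof. by move=> u; apply/asboolP; exists 0; rewrite subrr map_mx0 mulmx0. Qed.

Lemma lattice_eq_sym Z : symmetric (lattice_eq Z).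
Proof.
suff sym u v : lattice_eq Z u v -> lattice_eq Z v u.
  by move=> u v; apply/idP/idP; exact: sym.
move=> /asboolP[m mE]; apply/asboolP; exists (- m).
by rewrite map_mxN mulmxN -mE opprB.
Qed.

Lemma lattice_eq_trans Z : transitive (lattice_eq Z).
Proof.
move=> v u w /asboolP[m mE] /asboolP[n nE]; apply/asboolP; exists (m + n).
by rewrite map_mxD mulmxDr -mE -nE subrKA.
Qed.

Canonical lattice_eq_equiv Z : equiv_rel 'cV[R[i]]_g :=
  EquivRel (lattice_eq Z) (@lattice_eq_refl Z) (@lattice_eq_sym Z)
    (@lattice_eq_trans Z).

Definition torus Z := {eq_quot lattice_eq Z}.

Definition torus_opp Z (x : torus Z) : torus Z := \pi_(torus Z) (- repr x).

Lemma torus_oppE Z (u : 'cV[R[i]]_g) :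
  torus_opp (\pi_(torus Z) u) = \pi_(torus Z) (- u).
Proof.
apply/eqmodP; rewrite /= /lattice_eq opprK.
have /eqmodP/asboolP[m mE] : \pi_(torus Z) (repr (\pi_(torus Z) u)) = \pi_(torus Z) u.
  by rewrite reprK.
by apply/asboolP; exists (- m); rewrite map_mxN mulmxN -mE opprB addrC.
Qed.

(* The coordinates of u in the real basis of C^g formed by the columns of
   [period Z]; see [coordK]. *)
Definition coord Z (u : 'cV[R[i]]_g) : 'cV[R]_(g + g) :=
  let b := invmx (ImM Z) *m ImM u in col_mx (ReM u - ReM Z *m b) b.

Lemma posdef_unit (Y : 'M[R]_g) : posdef Y -> Y \in unitmx.
Proof.
move=> Ypos; rewrite -row_free_unit -kermx_eq0; apply/eqP/row_matrixP => k.
rewrite row0; apply: contrapT => /eqP w0.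
have := Ypos (row k (kermx Y))^T; rewrite trmx_eq0 => /(_ w0).
have /sub_kermxP kY : (row k (kermx Y) <= kermx Y)%MS by exact: row_sub.
by rewrite trmxK kY mul0mx mxE ltxx.
Qed.

Lemma coordK Z (u : 'cV[R[i]]_g) : siegel Z ->
  period Z *m map_mx (real_complex R) (coord Z u) = u.
Proof.
move=> [_ /posdef_unit Yu]; rewrite /coord map_col_mx /period mul_row_col mul1mx.
set b := _ *m ImM u.
have Yb : ImM Z *m b = ImM u by rewrite /b mulKVmx.
apply/colP => i; apply/eqP; rewrite eq_complex.
move/colP/(_ i): Yb; rewrite !mxE !raddfD /= !raddf_sum /= add0r => <-.
apply/andP; split; apply/eqP; last first.
  rewrite add0r.
  by apply: eq_bigr => j _; rewrite !mxE; case: (Z i j) => x y /=; simpc.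
rewrite sumrN -[RHS](subrK (\sum_j ReM Z i j * b j 0)); congr (_ - _ + _).
by apply: eq_bigr => j _; rewrite !mxE; case: (Z i j) => x y /=; simpc.
Qed.

(* The polarization, as a real alternating form on C^g. *)
Definition polarization Z (u v : 'cV[R[i]]_g) : R :=
  ((coord Z u)^T *m Jmx R g *m coord Z v) 0 0.

(* A homomorphism of complex tori is a map induced by a C-linear map F (its
   analytic representation); it is an isomorphism if it is bijective. *)
Definition ppav_iso Z W (f : torus Z -> torus W) : Prop :=
  bijective f /\
  exists F : 'M[R[i]]_g,
    (forall u, f (\pi_(torus Z) u) = \pi_(torus W) (F *m u)) /\
    (forall u v, polarization W (F *m u) (F *m v) = polarization Z u v).

Definition ppav_involution Z (f : torus Z -> torus Z) : Prop :=
  [/\ ppav_iso f, f \o f = id & f <> id].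

Definition involution_locus : set moduli :=
  [set x | exists Z : siegel, x = \pi_moduli Z /\
     exists f : torus (val Z) -> torus (val Z),
       ppav_involution f /\ f <> @torus_opp (val Z)].

End Siegel.

(* Main.v *)
Require Import Defs.
From mathcomp Require Import all_boot all_order all_algebra.
From mathcomp Require Import all_classical all_reals all_analysis.
From mathcomp Require Import complex ring zify.

(** A ppav with an involution other than [-id] has a period matrix [Z] with
    [F (1 Z) = (1 Z) M], where [F] is the analytic representation of the
    involution and [M] is an integral symplectic matrix with [M ^ 2 = 1] and
    [M <> 1, -1] ([involution_rep]).

    The arithmetic input is a normal form for such matrices: [M] is conjugate
    in [Sp(2g, Z)] to [diag(A, A)] with [A] an integral [g x g] matrix
    ([involution_normal_form]).  It is obtained by splitting off, one after the
    other, [M]-stable unimodular pieces of rank 2, on which [M] is [1] or [-1],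
    or of rank 4, on which [M] exchanges two orthogonal hyperbolic planes
    ([frame_extend]).

    Changing the symplectic basis replaces [Z] by another point [W] of the same
    orbit, and the relation above becomes [A W = W A].  This condition is
    linear in [W], and it holds for the scalar matrix ['i%:M] whatever [A] is.
    The curve [(1 - t) ^ 2 'i%:M + t ^ 2 W] therefore stays inside the Siegel
    space and commutes with [A], so that its image in the moduli space stays
    inside the locus ([standard_in_locus]) and joins the class of [W] to the
    class of ['i%:M].  The locus is thus a union of connected sets having a
    point in common, the class of the g-th power of the elliptic curve with
    complex multiplication by ['i]. *)

Set Implicit Arguments.
Unset Strict Implicit.
Unset Printing Implicit Defensive.

Import Order.TTheory GRing.Theory Num.Theory numFieldNormedType.Exports Defs.

Local Open Scope ring_scope.

(** * Integral column vectors *)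

Lemma scale_int_inj n (c : int) (s t : 'cV[int]_n) : c != 0 -> c *: s = c *: t -> s = t.
Proof.
move=> c0 /eqP; rewrite -subr_eq0 -scalerBr scalemx_eq0 (negPf c0) subr_eq0.
by move/eqP.
Qed.

Lemma odd_intP (c : int) : (forall c', c <> 2 * c') -> exists c', c = 2 * c' + 1.
Proof.
by move=> c_odd; exists (c %/ 2)%Z; have := c_odd (c %/ 2)%Z; lia.
Qed.

(** The row [a] is a Bezout relation between the entries of the primitive
    vector [v0]; all three are read off the Smith normal form of [v]. *)
Lemma primitive_part n (v : 'cV[int]_n) : v != 0 ->
  exists (d : int) v0 (a : 'rV_n), [/\ d != 0, v = d *: v0 & a *m v0 = 1].
Proof.
have [L Lu [P Pu [d _ vE]]] := int_Smith_normal_form v.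
case: n v L Lu vE => [|n] v L Lu vE; first by rewrite [v]flatmx0 eqxx.
have vE' : v = d`_0 *: (L *m delta_mx 0 0 *m P).
  rewrite {1}vE scalemxAl scalemxAr; congr (_ *m _ *m _).
  apply/matrixP => i j; rewrite !mxE !ord1 andbT.
  by rewrite mulr_natr -[(i == 0) in RHS]val_eqE /=; case: eqP => [->|//].
move=> v0; exists d`_0, (L *m delta_mx 0 0 *m P), (invmx P *m delta_mx 0 0 *m invmx L).
split=> //; first by apply: contraNneq v0 => d0; rewrite vE' d0 scale0r.
rewrite !mulmxA mulmxKV // -(mulmxA (invmx P)) mul_delta_mx.
have -> : delta_mx 0 0 = 1 :> 'M[int]_1 by apply/matrixP => i j; rewrite !mxE !ord1.
by rewrite mulmx1 mulVmx.
Qed.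

(** * Involutions of unimodular symplectic lattices *)

Section Frame.
Variables (n : nat) (G M : 'M[int]_n).
Hypotheses (Gskew : G^T = - G) (Gunit : G \in unitmx).
Hypotheses (MG : M^T *m G *m M = G) (MM : M *m M = 1%:M).

(** A partial symplectic basis adapted to [M]: each of the two isotropic halves
    is [M]-stable, and the matrix of [M] on their sum is [diag(A, A)]. *)
Definition frame k (X Y : 'M[int]_(n, k)) (A : 'M[int]_k) : Prop :=
  [/\ X^T *m G *m X = 0, Y^T *m G *m Y = 0, X^T *m G *m Y = 1%:M,
      M *m X = X *m A & M *m Y = Y *m A].

Definition orthog k r (X Y : 'M[int]_(n, k)) (U : 'M[int]_(n, r)) : Prop :=
  X^T *m G *m U = 0 /\ Y^T *m G *m U = 0.

Definition pairing (u v : 'cV[int]_n) : int := (u^T *m G *m v) 0 0.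

Lemma pairingDl u u' v : pairing (u + u') v = pairing u v + pairing u' v.
Proof. by rewrite /pairing linearD /= !mulmxDl mxE. Qed.
Lemma pairingDr u v v' : pairing u (v + v') = pairing u v + pairing u v'.
Proof. by rewrite /pairing mulmxDr mxE. Qed.
Lemma pairingZl c u v : pairing (c *: u) v = c * pairing u v.
Proof. by rewrite /pairing linearZ /= -!scalemxAl mxE. Qed.
Lemma pairingZr c u v : pairing u (c *: v) = c * pairing u v.
Proof. by rewrite /pairing -!scalemxAr mxE. Qed.
Lemma pairingNl u v : pairing (- u) v = - pairing u v.
Proof. by rewrite -scaleN1r pairingZl mulN1r. Qed.
Lemma pairingNr u v : pairing u (- v) = - pairing u v.
Proof. by rewrite -scaleN1r pairingZr mulN1r. Qed.

Definition pairing_linear := (pairingDl, pairingDr, pairingNl, pairingNr, pairingZl, pairingZr).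

Lemma trmx_gram p q (U : 'M[int]_(n, p)) (V : 'M[int]_(n, q)) :
  (U^T *m G *m V)^T = - (V^T *m G *m U).
Proof. by rewrite !trmx_mul trmxK Gskew mulNmx mulmxN mulmxA. Qed.

Lemma gram_eq0C p q (U : 'M[int]_(n, p)) (V : 'M[int]_(n, q)) :
  U^T *m G *m V = 0 -> V^T *m G *m U = 0.
Proof. by move=> UV; apply: oppr_inj; rewrite -trmx_gram UV trmx0 oppr0. Qed.

Lemma pairingC u v : pairing u v = - pairing v u.
Proof.
rewrite /pairing; have -> : (u^T *m G *m v) 0 0 = (u^T *m G *m v)^T 0 0 by rewrite [RHS]mxE.
by rewrite trmx_gram mxE.
Qed.

Lemma pairing_alt u : pairing u u = 0.
Proof. have := pairingC u u; lia. Qed.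

Lemma involution_adjoint : G *m M = M^T *m G.
Proof. by rewrite -[RHS]mulmx1 -MM mulmxA MG. Qed.

Lemma pairing_swap u v : pairing (M *m u) v = pairing u (M *m v).
Proof. by rewrite /pairing trmx_mul -(mulmxA u^T) -involution_adjoint !mulmxA. Qed.

Lemma frame_cat k r (X Y : 'M[int]_(n, k)) (A : 'M[int]_k) (X' Y' : 'M[int]_(n, r)) (A' : 'M[int]_r) :
  frame X Y A -> frame X' Y' A' -> orthog X Y X' -> orthog X Y Y' ->
  frame (row_mx X X') (row_mx Y Y') (block_mx A 0 0 A').
Proof.
move=> [XX YY XY MX MY] [XX' YY' XY' MX' MY'] [XX1 YX1] [XY1 YY1].
split; rewrite ?tr_row_mx ?mul_col_mx ?mul_mx_row ?mul_row_block
  ?mulmx0 ?addr0 ?add0r ?MX ?MX' ?MY ?MY' //.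
- by rewrite -block_mxEv XX XX1 XX' gram_eq0C // block_mx0.
- by rewrite -block_mxEv YY YY1 YY' gram_eq0C // block_mx0.
- by rewrite -block_mxEv XY XY1 XY' [X'^T *m G *m Y]gram_eq0C // -scalar_mx_block.
Qed.

(** The projection onto the orthogonal complement of a frame; it is integral
    because the span of a frame is unimodular. *)
Definition orth_proj k (X Y : 'M[int]_(n, k)) : 'M[int]_n :=
  1%:M + X *m Y^T *m G - Y *m X^T *m G.

Section Complement.
Variables (k : nat) (X Y : 'M[int]_(n, k)) (A : 'M[int]_k).
Hypothesis XYframe : frame X Y A.
Implicit Types u v : 'cV[int]_n.

Lemma frameYX : Y^T *m G *m X = - 1%:M.
Proof.
by case: XYframe => _ _ XY _ _; rewrite -[LHS]opprK -trmx_gram XY trmx1.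
Qed.

Lemma orthog_proj r (V : 'M[int]_(n, r)) : orthog X Y (orth_proj X Y *m V).
Proof.
case: XYframe => XX YY XY _ _; split; rewrite /orth_proj !mulmxA.
  by rewrite mulmxBr mulmxDr mulmx1 !mulmxA XX XY !mul0mx mul1mx addr0 subrr mul0mx.
rewrite mulmxBr mulmxDr mulmx1 !mulmxA YY frameYX !mul0mx subr0.
by rewrite mulNmx mul1mx mulNmx subrr mul0mx.
Qed.

Lemma pairing_proj u v : orthog X Y u -> pairing u (orth_proj X Y *m v) = pairing u v.
Proof.
move=> [/gram_eq0C uX /gram_eq0C uY]; rewrite /pairing /orth_proj.
rewrite mulmxA mulmxBr mulmxDr mulmx1 !mulmxA uX uY !mul0mx.
by rewrite addr0 subr0.
Qed.

Lemma orthog_stable u : orthog X Y u -> orthog X Y (M *m u).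
Proof.
move=> [Xu Yu]; case: XYframe => _ _ _ MX MY.
split; rewrite mulmxA -(mulmxA _ G) involution_adjoint !mulmxA -trmx_mul (MX, MY) trmx_mul.
  by rewrite -!mulmxA (mulmxA X^T) Xu mulmx0.
by rewrite -!mulmxA (mulmxA Y^T) Yu mulmx0.
Qed.

Lemma orthogD u v : orthog X Y u -> orthog X Y v -> orthog X Y (u + v).
Proof.
by move=> [Xu Yu] [Xv Yv]; split; rewrite mulmxDr ?Xu ?Xv ?Yu ?Yv addr0.
Qed.

Lemma orthogZ c u : orthog X Y u -> orthog X Y (c *: u).
Proof. by move=> [Xu Yu]; split; rewrite -scalemxAr ?Xu ?Yu scaler0. Qed.

Lemma orthogN u : orthog X Y u -> orthog X Y (- u).
Proof. by rewrite -scaleN1r; exact: orthogZ. Qed.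

Lemma orthogZ_inv c u : c != 0 -> orthog X Y (c *: u) -> orthog X Y u.
Proof.
move=> c0 [Xu Yu]; split; apply/eqP; move/eqP: Xu; move/eqP: Yu;
by rewrite -!scalemxAr !scalemx_eq0 (negPf c0).
Qed.

Lemma frame_size : (k + k <= n)%N.
Proof.
case: XYframe => XX YY XY _ _.
apply: (@mulmx1_min _ _ _ (col_mx (- (Y^T *m G)) (X^T *m G)) (row_mx X Y)).
rewrite mul_col_row !mulNmx XX YY XY frameYX opprK oppr0.
by rewrite -scalar_mx_block.
Qed.

(** Otherwise [orth_proj X Y] vanishes and the identity of rank [n] factors
    through rank [k + k]. *)
Lemma orthog_neq0 : (k + k < n)%N -> exists2 u : 'cV_n, u != 0 & orthog X Y u.
Proof.
move=> kn; have [P0|/eqP/matrixP P0] := eqVneq (orth_proj X Y) 0.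
  have : (n <= k + k)%N.
    apply: (@mulmx1_min _ _ _ (row_mx (- X) Y) (col_mx (Y^T *m G) (X^T *m G))).
    apply/eqP; rewrite mul_row_col mulNmx -subr_eq0 -oppr_eq0 opprB opprD opprK.
    by rewrite !mulmxA addrA -/(orth_proj X Y) P0.
  by rewrite leqNgt kn.
have [j Pj] : exists j, col j (orth_proj X Y) != 0.
  apply: contrapT => /forallNP P00; apply: P0 => i j.
  by have /negP/negPn/eqP/colP/(_ i) := P00 j; rewrite !mxE.
by exists (col j (orth_proj X Y)) => //; rewrite colE; exact: orthog_proj.
Qed.

(** By unimodularity of [G] a primitive vector pairs to 1 with some vector, and
    projecting the latter to the complement does not change the pairing. *)
Lemma orthog_primitive u : orthog X Y u -> u != 0 ->
  exists (d : int) u0 a, [/\ d != 0, u = d *: u0, orthog X Y u0, orthog X Y a & pairing u0 a = 1].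
Proof.
move=> uXY /primitive_part[d [u0 [a [d0 uE au0]]]].
have u0XY : orthog X Y u0 by apply: (@orthogZ_inv d) => //; rewrite -uE.
exists d, u0, (orth_proj X Y *m (invmx G *m a^T)); split=> //.
  exact: orthog_proj.
rewrite pairing_proj // /pairing -mulmxA mulKVmx //.
by rewrite -trmx_mul au0 trmx1 mxE.
Qed.

End Complement.

Lemma gram_cV (x y : 'cV[int]_n) : x^T *m G *m y = (pairing x y)%:M.
Proof. exact: mx11_scalar. Qed.

Lemma frame_eigen (x y : 'cV_n) (e : int) : pairing x y = 1 ->
  M *m x = e *: x -> M *m y = e *: y -> frame x y (e%:M : 'M[int]_1).
Proof.
move=> xy Mx My; split; rewrite ?mul_mx_scalar //.
- by rewrite gram_cV pairing_alt raddf0.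
- by rewrite gram_cV pairing_alt raddf0.
- by rewrite gram_cV xy.
Qed.

Lemma frame_swap (x y : 'cV_n) : pairing x y = 1 -> pairing (M *m x) y = 0 ->
  frame (row_mx x (M *m x)) (row_mx y (M *m y))
    (block_mx 0 1%:M 1%:M 0 : 'M[int]_(1 + 1)).
Proof.
move=> xy Mxy.
have xMy : pairing x (M *m y) = 0 by rewrite -pairing_swap.
have anti z : pairing z (M *m z) = 0.
  have := pairing_swap z z; have := pairingC z (M *m z); lia.
have MMz z : M *m (M *m z) = z by rewrite mulmxA MM mul1mx.
split; rewrite ?tr_row_mx ?mul_col_mx ?mul_mx_row ?mul_row_block ?mulmx0 ?mulmx1
  ?addr0 ?add0r ?MMz //.
- by rewrite !gram_cV !pairing_alt pairing_swap anti raddf0 -block_mxEv block_mx0.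
- by rewrite !gram_cV !pairing_alt pairing_swap anti raddf0 -block_mxEv block_mx0.
- by rewrite !gram_cV xMy Mxy pairing_swap MMz xy raddf0 -block_mxEv -scalar_mx_block.
Qed.

Section Extension.
Variables (k : nat) (X Y : 'M[int]_(n, k)) (A : 'M[int]_k).
Hypothesis XYframe : frame X Y A.
Implicit Types u v x y : 'cV[int]_n.

(** If [M] is not congruent to 1 modulo 2 on the complement, a hyperbolic plane
    and its image under [M] split off: [x] and [y] below satisfy
    [pairing x (M y) = 0] as well, by symmetry.  Let [v] and [w] be the primitive
    vectors proportional to [u + M u] and [u - M u]; the factors are odd because
    [u] and [M u] differ modulo 2, so [x = (v + w) / 2] is integral and
    [M x = (v - w) / 2].  It remains to find [y] pairing to 1 with both [v] and
    [w]. *)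
Lemma swap_extension u : orthog X Y u -> (forall z, u + M *m u <> 2 *: z) ->
  exists x y, [/\ orthog X Y x, orthog X Y y, pairing x y = 1 & pairing (M *m x) y = 0].
Proof.
move=> uXY odd_u.
have MuXY := orthog_stable XYframe uXY.
have v_neq0 : u + M *m u != 0 by apply/eqP => v0; apply: (odd_u 0); rewrite v0 scaler0.
have w_neq0 : u - M *m u != 0.
  apply/eqP => w0; apply: (odd_u u); rewrite scaler_nat mulr2n.
  by move/eqP: w0; rewrite subr_eq0 => /eqP <-.
have [c [v [a [c0 vE vXY aXY va]]]] := orthog_primitive XYframe (orthogD uXY MuXY) v_neq0.
have [d [w [b [d0 wE wXY bXY wb]]]] :=
  orthog_primitive XYframe (orthogD uXY (orthogN MuXY)) w_neq0.
have Mv : M *m v = v.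
  by apply: (@scale_int_inj _ c) => //; rewrite scalemxAr -vE mulmxDr mulmxA MM mul1mx addrC.
have Mw : M *m w = - w.
  apply: (@scale_int_inj _ d) => //; rewrite scalemxAr scalerN -wE mulmxBr mulmxA MM mul1mx.
  by rewrite opprB.
have [c' cE] : exists c' : int, c = 2 * c' + 1.
  by apply: odd_intP => c' cE; apply: (odd_u (c' *: v)); rewrite vE cE scalerA.
have [d' dE] : exists d' : int, d = 2 * d' + 1.
  apply: odd_intP => d' dE; apply: (odd_u (u - d' *: w)).
  rewrite scalerBr scalerA -dE -wE.
  by move: (M *m u) => Mu; apply/colP => i; rewrite !mxE; ring.
(* [(v + w) / 2] is integral, being congruent to [u] modulo [v] and [w]. *)
pose x := u - c' *: v - d' *: w.
have xXY : orthog X Y x.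
  by apply: orthogD; [apply: orthogD => //|]; apply/orthogN/orthogZ.
have x2 : 2 *: x = v + w.
  move: (M *m u) vE wE => Mu /colP vE /colP wE; apply/colP => i.
  move: (vE i) (wE i); rewrite /x !mxE cE dE => vi wi.
  have -> : 2 * (u i 0 - c' * v i 0 - d' * w i 0) =
      (u i 0 + Mu i 0) + (u i 0 - Mu i 0) - 2 * c' * v i 0 - 2 * d' * w i 0 by ring.
  by rewrite vi wi; ring.
have Mx2 : 2 *: (M *m x) = v - w by rewrite scalemxAr x2 mulmxDr Mv Mw.
clearbody x; pose t := pairing x a.
(* [b - M b] pairs to 0 with [v] and to 2 with [w]; the multiple of it that is
   subtracted brings the pairing with [w], which is odd, down to 1. *)
pose y := a - (t - 1) *: (b - M *m b).
have yXY : orthog X Y y.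
  apply: orthogD => //; apply/orthogN/orthogZ/orthogD => //.
  exact/orthogN/(orthog_stable XYframe).
have vy : pairing v y = 1.
  by rewrite !pairing_linear -pairing_swap Mv va subrr mulr0 subr0.
have wa : pairing w a = 2 * t - 1.
  have -> : w = 2 *: x - v by rewrite x2 addrC addKr.
  by rewrite !pairing_linear va.
have wy : pairing w y = 1.
  by rewrite !pairing_linear -pairing_swap Mw wa !pairing_linear wb; lia.
clearbody y.
have xy2 : 2 * pairing x y = 2 by rewrite -pairingZl x2 pairingDl vy wy.
have Mxy2 : 2 * pairing (M *m x) y = 0 by rewrite -pairingZl Mx2 !pairing_linear vy wy.
by exists x, y; split=> //; lia.
Qed.

(** If [M] is congruent to 1 modulo 2 on the complement, then [(a + e M a) / 2]
    is integral for [e = 1, -1], so that the complement is the orthogonal sum of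
    the two eigenlattices and a hyperbolic plane splits off one of them. *)
Lemma eigen_extension u : orthog X Y u -> u != 0 ->
  (forall v, orthog X Y v -> exists z, v + M *m v = 2 *: z) ->
  exists x y (e : int), [/\ orthog X Y x, orthog X Y y, pairing x y = 1,
    M *m x = e *: x & M *m y = e *: y].
Proof.
move=> uXY u0 even_M.
have [e [v [ee vXY v0 Mv]]] : exists (e : int) v,
    [/\ e = 1 \/ e = -1, orthog X Y v, v != 0 & M *m v = e *: v].
  have MuXY := orthog_stable XYframe uXY.
  have [v0|v0] := eqVneq (u + M *m u) 0.
    exists (-1), u; split=> //; first by right.
    by apply/eqP; rewrite scaleN1r -addr_eq0 addrC v0.
  exists 1, (u + M *m u); split=> //; [by left|exact: orthogD|].
  by rewrite mulmxDr mulmxA MM mul1mx scale1r addrC.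
have [d [x [a [d0 vE xXY aXY xa]]]] := orthog_primitive XYframe vXY v0.
have Mx : M *m x = e *: x.
  by apply: (@scale_int_inj _ d) => //; rewrite scalemxAr -vE Mv vE !scalerA mulrC.
have [y y2] : exists y, a + e *: (M *m a) = 2 *: y.
  have [z zE] := even_M a aXY.
  case: ee => ->; first by exists z; rewrite scale1r.
  exists (a - z); rewrite scaleN1r scalerBr -zE scaler_nat mulr2n opprD addrA.
  by rewrite addrK.
have eE : e * e = 1 by case: ee => ->.
exists x, y, e; split=> //.
- apply: (@orthogZ_inv _ _ _ 2) => //; rewrite -y2; apply: orthogD => //.
  exact/orthogZ/(orthog_stable XYframe).
- have : 2 * pairing x y = 2.
    by rewrite -pairingZr -y2 !pairing_linear -pairing_swap Mx pairingZl xa mulr1 eE.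
  by lia.
- apply: (@scale_int_inj _ 2) => //; rewrite scalemxAr [RHS]scalerA [2 * e]mulrC -scalerA -y2 mulmxDr -scalemxAr.
  by rewrite mulmxA MM mul1mx scalerDr scalerA eE scale1r addrC.
Qed.

Lemma frame_extend : (k + k < n)%N -> exists r, exists (X' Y' : 'M[int]_(n, r)) A',
  [/\ (0 < r)%N, frame X' Y' A', orthog X Y X' & orthog X Y Y'].
Proof.
move=> kn; have [u u0 uXY] := orthog_neq0 XYframe kn.
have [even_M|] := pselect (forall v, orthog X Y v -> exists z, v + M *m v = 2 *: z).
  have [x [y [e [xXY yXY xy Mx My]]]] := eigen_extension uXY u0 even_M.
  by exists 1, x, y, e%:M; split=> //; exact: frame_eigen.
move=> /existsNP[v /not_implyP[vXY /forallNP odd_v]].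
have [x [y [xXY yXY xy Mxy]]] := swap_extension vXY odd_v.
have orthog_row (z : 'cV_n) : orthog X Y z -> orthog X Y (row_mx z (M *m z)).
  move=> zXY; have [XMz YMz] := orthog_stable XYframe zXY; case: zXY => Xz Yz.
  by split; rewrite mul_mx_row ?Xz ?Yz ?XMz ?YMz row_mx0.
exists (1 + 1)%N, (row_mx x (M *m x)), (row_mx y (M *m y)), (block_mx 0 1%:M 1%:M 0).
by split=> //; [exact: frame_swap|exact: orthog_row|exact: orthog_row].
Qed.

End Extension.

(** A frame of maximal size spans the whole lattice. *)
Lemma involution_frame : exists k, exists (X Y : 'M[int]_(n, k)) A,
  (k + k = n)%N /\ frame X Y A.
Proof.
pose P k := `[< exists (X Y : 'M[int]_(n, k)) A, frame X Y A >].
have P0 : exists k, P k.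
  exists 0; apply/asboolP; exists 0, 0, 0.
  by split; rewrite ?mulmx0 //; apply/matrixP => - [].
have Pn k : P k -> (k <= n)%N.
  move=> /asboolP[X [Y [A XY]]]; exact: leq_trans (leq_addr _ _) (frame_size XY).
have [k /asboolP[X [Y [A XY]]] kmax] := ex_maxnP P0 Pn.
exists k, X, Y, A; split=> //; apply/eqP; rewrite eqn_leq (frame_size XY) leqNgt.
apply/negP => /(frame_extend XY)[r [X' [Y' [A' [r0 XY' XX' YY']]]]].
have /kmax : P (k + r)%N.
  by apply/asboolP; do 3!eexists; exact: frame_cat XY XY' XX' YY'.
by lia.
Qed.

End Frame.

Local Open Scope classical_set_scope.
Local Open Scope complex_scope.
Local Open Scope quotient_scope.

(** * Involutions in the symplectic group *)

Definition diag2 (K : pzRingType) g (A : 'M[K]_g) : 'M[K]_(g + g) := block_mx A 0 0 A.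

Lemma Jmx_skew g : (Jmx int g)^T = - Jmx int g.
Proof. by rewrite /Jmx tr_block_mx !trmx0 linearN /= trmx1 opp_block_mx opprK oppr0. Qed.

Lemma Jmx_unit g : Jmx int g \in unitmx.
Proof.
have /mulmx1_unit[] // : Jmx int g *m - Jmx int g = 1%:M.
by rewrite mulmxN Jmx_sqr opprK.
Qed.

Lemma diag2_inj (K : pzRingType) g (A B : 'M[K]_g) : diag2 A = diag2 B -> A = B.
Proof. by move=> /eq_block_mx[]. Qed.

Lemma diag2M (K : pzRingType) g (A B : 'M[K]_g) : diag2 A *m diag2 B = diag2 (A *m B).
Proof. by rewrite /diag2 mulmx_block !(mulmx0, mul0mx, addr0, add0r). Qed.

Lemma diag2_1 (K : pzRingType) g : diag2 (1%:M : 'M[K]_g) = 1%:M.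
Proof. by rewrite /diag2 -scalar_mx_block. Qed.

Lemma diag2N (K : pzRingType) g (A : 'M[K]_g) : diag2 (- A) = - diag2 A.
Proof. by rewrite /diag2 opp_block_mx oppr0. Qed.

Lemma involution_normal_form g (M : 'M[int]_(g + g)) : Sp M -> M *m M = 1%:M ->
  exists S A, Sp S /\ M *m S = S *m diag2 A.
Proof.
move=> SpM MM.
have [k [X [Y [A [kg XYA]]]]] := involution_frame (Jmx_skew g) (Jmx_unit g) SpM MM.
have ? : k = g by lia.
subst k; have YX := frameYX (Jmx_skew g) XYA; case: XYA => XX YY XY MX MY.
exists (row_mx X Y), A; split.
  by rewrite /Sp /= tr_row_mx mul_col_mx mul_col_row XX YY XY YX.
by rewrite mul_mx_row mul_row_block !mulmx0 addr0 add0r MX MY.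
Qed.

(** * Period lattices *)

Lemma eq_col_mx T p q (A B : 'M[T]_(p, q)) : (forall j, col j A = col j B) -> A = B.
Proof.
by move=> AB; apply/matrixP => i j; have /colP/(_ i) := AB j; rewrite !mxE.
Qed.

Lemma intr_mx_inj (R : numDomainType) p q (A B : 'M[int]_(p, q)) :
  map_mx intr A = map_mx intr B :> 'M[R]_(p, q) -> A = B.
Proof.
by move=> /matrixP AB; apply/matrixP => i j; have := AB i j; rewrite !mxE => /intr_inj.
Qed.

Lemma map_Jmx (K : pzRingType) g : map_mx intr (Jmx int g) = Jmx K g.
Proof. by rewrite /Jmx map_block_mx !map_mx0 map_mxN map_mx1. Qed.

Section Lattices.
Variables (R : realType) (g : nat).
Implicit Types (Z W : 'M[R[i]]_g) (u v : 'cV[R[i]]_g).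
Local Notation toC := (map_mx (real_complex R)).

Lemma coord_period Z (m : 'cV[R]_(g + g)) : siegel Z -> coord Z (period Z *m toC m) = m.
Proof.
move=> [_ /posdef_unit Yu]; rewrite -[m]vsubmxK; set a := usubmx m; set b := dsubmx m.
rewrite map_col_mx /period mul_row_col mul1mx /coord.
have -> : ImM (toC a + Z *m toC b) = ImM Z *m b.
  apply/colP => i; rewrite !mxE raddfD /= add0r raddf_sum; apply: eq_bigr => j _.
  by rewrite !mxE; case: (Z i j) => x y /=; rewrite mulr0 add0r.
have -> : ReM (toC a + Z *m toC b) = a + ReM Z *m b.
  apply/colP => i; rewrite !mxE raddfD /= raddf_sum; congr (_ + _).
  by apply: eq_bigr => j _; rewrite !mxE; case: (Z i j) => x y /=; rewrite mulr0 subr0.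
by rewrite mulKmx // addrK.
Qed.

Lemma toC_intr p q (m : 'M[int]_(p, q)) : toC (map_mx intr m) = map_mx intr m.
Proof. by apply/matrixP => i j; rewrite !mxE rmorph_int. Qed.

Lemma period_inj Z q (m n : 'M[int]_(g + g, q)) : siegel Z ->
  period Z *m map_mx intr m = period Z *m map_mx intr n -> m = n.
Proof.
move=> Zs mn; apply: eq_col_mx => j; apply: (@intr_mx_inj R).
rewrite -[LHS](coord_period _ Zs) -[RHS](coord_period _ Zs) !toC_intr.
by rewrite !map_col !colE !mulmxA mn.
Qed.

(** A linear map with values in a lattice is zero, since its image is stable
    under real scaling. *)
Lemma lattice_full_eq0 Z (G : 'M[R[i]]_g) : siegel Z ->
  (forall u, lattice Z (G *m u)) -> G = 0.
Proof.
move=> Zs Glat; apply: eq_col_mx => j; rewrite col0 colE.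
have [m mE] := Glat (delta_mx j 0).
suff m0 : m = 0 by rewrite mE m0 map_mx0 mulmx0.
apply/colP => k; rewrite mxE; apply: contrapT => /eqP mk.
(* Scaling by [t] turns the [k]-th coordinate of [m] into 1/2. *)
pose t : R := (2 * (m k 0)%:~R)^-1.
have [n nE] := Glat (t%:C *: delta_mx j 0).
have tmn : t *: map_mx intr m = map_mx intr n :> 'cV[R]_(g + g).
  rewrite -[LHS](coord_period _ Zs) -[RHS](coord_period _ Zs) toC_intr -nE.
  by rewrite map_mxZ toC_intr -!scalemxAr -mE.
have /colP/(_ k) := tmn; rewrite !mxE /t => tn.
have : (1 : R) = (2 * n k 0)%:~R.
  rewrite intrM -tn invfM -mulrA mulVf ?intr_eq0 // mulr1.
  by rewrite divff ?pnatr_eq0.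
by move=> /(@intr_inj R 1); lia.
Qed.

Lemma torus_pi_eq Z u v : \pi_(torus Z) u = \pi_(torus Z) v <-> lattice Z (u - v).
Proof. by split=> [/eqmodP/asboolP|uv] //; apply/eqmodP/asboolP. Qed.

Lemma torus_surj Z (x : torus Z) : exists u, x = \pi_(torus Z) u.
Proof. by exists (repr x); rewrite reprK. Qed.

End Lattices.

(** * Rational representations of torus endomorphisms *)

Section Torus.
Variables (R : realType) (g : nat).
Implicit Types (Z W : 'M[R[i]]_g) (u v : 'cV[R[i]]_g).
Local Notation toC := (map_mx (real_complex R)).

Lemma lattice_rational_rep Z (F : 'M[R[i]]_g) :
  (forall u, lattice Z u -> lattice Z (F *m u)) ->
  exists M : 'M[int]_(g + g), F *m period Z = period Z *m map_mx intr M.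
Proof.
move=> Flat.
have /choice[m mE] j : exists m : 'cV[int]_(g + g), F *m period Z *m delta_mx j 0 =
    period Z *m map_mx intr m.
  rewrite -mulmxA; apply: Flat; exists (delta_mx j 0).
  by rewrite map_delta_mx.
exists (\matrix_(i, j) m j i 0); apply: eq_col_mx => j.
rewrite colE mE colE -mulmxA; congr (_ *m _).
by rewrite -colE; apply/colP => i; rewrite !mxE.
Qed.

Lemma coord_mul Z (F : 'M[R[i]]_g) (M : 'M[int]_(g + g)) u : siegel Z ->
  F *m period Z = period Z *m map_mx intr M ->
  coord Z (F *m u) = map_mx intr M *m coord Z u.
Proof.
move=> Zs FM; rewrite -{1}(coordK u Zs) mulmxA FM -mulmxA -toC_intr -map_mxM.
exact: coord_period.
Qed.

Lemma polarization_Sp Z (F : 'M[R[i]]_g) (M : 'M[int]_(g + g)) : siegel Z ->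
  F *m period Z = period Z *m map_mx intr M ->
  (forall u v, polarization Z (F *m u) (F *m v) = polarization Z u v) <-> Sp M.
Proof.
move=> Zs FM.
have polE u v : polarization Z (F *m u) (F *m v) =
    ((coord Z u)^T *m map_mx intr (M^T *m Jmx int g *m M) *m coord Z v) 0 0.
  rewrite /polarization !(coord_mul _ Zs FM) trmx_mul !map_mxM -matrix.map_trmx.
  by rewrite map_Jmx !mulmxA.
have JE : Jmx R g = map_mx intr (Jmx int g) by rewrite map_Jmx.
split=> [pol|SpM u v]; last by rewrite polE SpM /polarization JE.
apply: (@intr_mx_inj R); apply/matrixP => i j.
have := pol (period Z *m toC (delta_mx i 0)) (period Z *m toC (delta_mx j 0)).
rewrite polE /polarization !coord_period // JE trmx_delta.
by rewrite -!rowE -!colE [LHS]mxE [RHS]mxE ![row _ _ _ _]mxE.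
Qed.

Lemma period_rep_inj Z (F F' : 'M[R[i]]_g) :
  F *m period Z = F' *m period Z -> F = F'.
Proof. by rewrite /period !mul_mx_row !mulmx1 => /eq_row_mx[]. Qed.

Lemma involution_rep Z (f : torus Z -> torus Z) : siegel Z ->
  ppav_involution f -> f <> @torus_opp R g Z ->
  exists (F : 'M[R[i]]_g) (M : 'M[int]_(g + g)),
    [/\ F *m period Z = period Z *m map_mx intr M, Sp M, M *m M = 1%:M, M <> 1%:M
      & M <> - 1%:M].
Proof.
move=> Zs [[_ [F [fF polF]]] ff f1] fN.
have Flat u : lattice Z u -> lattice Z (F *m u).
  move=> ul; have u0 : \pi_(torus Z) u = \pi_(torus Z) 0 by apply/torus_pi_eq; rewrite subr0.
  suff : lattice Z (F *m u - F *m 0) by rewrite mulmx0 subr0.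
  by apply/torus_pi_eq; rewrite -!fF u0.
have [M FM] := lattice_rational_rep Flat.
exists F, M; split=> //.
- exact/(polarization_Sp Zs FM).
- apply: (@period_inj R _ Z) => //; rewrite map_mxM mulmxA -FM -mulmxA -FM mulmxA.
  rewrite map_mx1 mulmx1 -[RHS]mul1mx; congr (_ *m _); apply/eqP; rewrite -subr_eq0.
  apply/eqP/(lattice_full_eq0 Zs) => u; rewrite mulmxBl mul1mx -mulmxA.
  by apply/torus_pi_eq; rewrite -!fF; exact: (congr1 (fun h => h (\pi u)) ff).
- move=> M1; apply: f1; apply/funext => x; have [u ->] := torus_surj x.
  rewrite fF; congr (\pi _).
  have -> : F = 1%:M.
    by apply: (@period_rep_inj Z); rewrite FM M1 map_mx1 mulmx1 mul1mx.
  by rewrite mul1mx.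
- move=> M1; apply: fN; apply/funext => x; have [u ->] := torus_surj x.
  rewrite fF torus_oppE; congr (\pi _).
  have -> : F = - 1%:M.
    by apply: (@period_rep_inj Z); rewrite FM M1 map_mxN map_mx1 mulmxN mulNmx mulmx1 mul1mx.
  by rewrite mulNmx mul1mx.
Qed.

End Torus.

(** * The symplectic action preserves the Siegel space *)

Section Action.
Variables (R : realType) (g : nat).
Implicit Types (Z W : 'M[R[i]]_g) (u v : 'cV[R[i]]_g).
Local Notation toC := (map_mx (real_complex R)).

(** The real and the imaginary part of [w] contribute separately: the cross
    terms are purely imaginary. *)
Lemma hermitian_gt0 (Y : 'M[R]_g) (w : 'rV[R[i]]_g) : posdef Y -> w != 0 ->
  0 < complex.Re ((w *m toC Y *m (map_mx conjc w)^T) 0 0).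
Proof.
move=> Ypos w0; pose q (v : 'rV[R]_g) := (v *m Y *m v^T) 0 0.
have q_gt0 (v : 'rV_g) : v != 0 -> 0 < q v.
  by move=> v0; have := Ypos v^T; rewrite trmxK; apply; rewrite trmx_eq0.
have q_ge0 (v : 'rV_g) : 0 <= q v.
  by have [->|/q_gt0/ltW//] := eqVneq v 0; rewrite /q !mul0mx mxE.
have -> : complex.Re ((w *m toC Y *m (map_mx conjc w)^T) 0 0) = q (ReM w) + q (ImM w).
  rewrite /q !mxE raddf_sum -big_split /=.
  apply: eq_bigr => j _; rewrite !mxE !mulr_suml raddf_sum -big_split /=.
  apply: eq_bigr => k _; rewrite !mxE.
  by case: (w 0 k) (w 0 j) => a b [c d] /=; simpc.
have [re0|/q_gt0 re0] := eqVneq (ReM w) 0; last by rewrite ltr_pwDl.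
rewrite ltr_wpDl // q_gt0 //; apply: contraNneq w0 => im0.
apply/eqP/rowP => j; move/rowP/(_ j): re0; move/rowP/(_ j): im0; rewrite !mxE.
by case: (w 0 j) => a b /= -> ->.
Qed.

Lemma period_gram Z Z' : period Z *m Jmx _ g *m (period Z')^T = Z'^T - Z.
Proof.
rewrite /period /Jmx mul_row_block tr_row_mx trmx1 !mulmx0 !mulmxN !mulmx1 addr0 add0r.
by rewrite mul_row_col mulmx1 mul1mx addrC.
Qed.

Lemma Sp_act_period (S : 'M[int]_(g + g)) Z : Sp S -> siegel Z ->
  exists2 P, P \in unitmx & P *m period (Sp_act S Z) = period Z *m map_mx intr S.
Proof.
move=> SpS Zs; have Pu := Sp_act_unit SpS Zs; eexists; first exact: Pu.
by rewrite period_mul /period mul_mx_row mulmx1 /Sp_act mulKVmx.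
Qed.

Lemma conjM_sub Z : map_mx conjc Z - Z = (- (2 * 'i)) *: toC (ImM Z).
Proof.
apply/matrixP => i j; rewrite !mxE; case: (Z i j) => a b.
apply/eqP; rewrite eq_complex /=; apply/andP; split; apply/eqP; ring.
Qed.

(** Riemann's relations for [period Z] express through [Jmx] that [Z] is
    symmetric and that its imaginary part is positive; a change of symplectic
    basis preserves both. *)
Lemma Sp_act_siegel (S : 'M[int]_(g + g)) Z : Sp S -> siegel Z -> siegel (Sp_act S Z).
Proof.
move=> SpS Zs; have [P Pu PW] := Sp_act_period SpS Zs; case: (Zs) => Zsym Zpos.
set W := Sp_act S Z in PW *.
have SJS : map_mx intr S *m Jmx R[i] g *m (map_mx intr S)^T = Jmx R[i] g.
  by rewrite -map_Jmx matrix.map_trmx -!map_mxM Sp_mulJT.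
have conjE (V : 'M[R[i]]_g) : map_mx conjc (period V) = period (map_mx conjc V).
  by rewrite /period map_row_mx map_mx1.
have conjPW : map_mx conjc P *m period (map_mx conjc W) =
    period (map_mx conjc Z) *m map_mx intr S.
  rewrite -!conjE -map_mxM PW map_mxM; congr (_ *m _).
  by apply/matrixP => i j; rewrite !mxE rmorph_int.
have gram_transfer (P' W' Z' : 'M[R[i]]_g) :
    P' *m period W' = period Z' *m map_mx intr S ->
    P *m (W'^T - W) *m P'^T = Z'^T - Z.
  move=> PW'; rewrite -!period_gram -[in RHS]SJS.
  by rewrite !mulmxA PW -[_ *m P'^T]mulmxA -trmx_mul PW' trmx_mul !mulmxA.
(* Taking [W' = W] gives the symmetry of [W]; [W'] the conjugate of [W] gives
   its imaginary part. *)
have Wsym : W^T = W.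
  apply/eqP; rewrite -subr_eq0; apply/eqP.
  have := gram_transfer _ _ _ PW; rewrite Zsym subrr => PWP.
  by rewrite -[_ - _](mulKmx Pu) -[P *m _](mulmxK (_ : P^T \in unitmx)) ?unitmx_tr // PWP !(mul0mx, mulmx0).
split=> // v v0.
have PYP : P *m toC (ImM W) *m (map_mx conjc P)^T = toC (ImM Z).
  have := gram_transfer _ _ _ conjPW; rewrite !matrix.map_trmx Wsym Zsym !conjM_sub.
  rewrite -scalemxAr -scalemxAl; apply: scalerI.
  by rewrite oppr_eq0 mulf_neq0 ?pnatr_eq0 // eq_complex /= oner_eq0 andbF.
pose w := (toC v)^T *m invmx P.
have w0 : w != 0.
  apply: contraNneq v0 => w0; apply/eqP/colP => i; rewrite mxE.
  have : w *m P = 0 by rewrite w0 mul0mx.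
  by rewrite /w mulmxKV // => /rowP/(_ i); rewrite !mxE => -[].
have := hermitian_gt0 Zpos w0; congr (0 < _).
have wP : w *m P = (toC v)^T by rewrite mulmxKV.
rewrite -PYP !mulmxA wP -(mulmxA (_ *m _)) -trmx_mul -map_mxM wP.
have -> : map_mx conjc (toC v)^T = (toC v)^T.
  by apply/matrixP => i j; rewrite !mxE /= oppr0.
by rewrite trmxK matrix.map_trmx -!map_mxM mxE.
Qed.

End Action.

(** * The locus as a union of linear sections *)

Section Locus.
Variables (R : realType) (g : nat).
Local Notation siegel := (@siegel R g).
Local Notation moduli := (moduli R g).

Definition commuting (A : 'M[int]_g) (W : 'M[R[i]]_g) : Prop :=
  map_mx intr A *m W = W *m map_mx intr A.

Definition standard_involution (A : 'M[int]_g) : Prop :=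
  [/\ Sp (diag2 A), A *m A = 1%:M, A <> 1%:M & A <> - 1%:M].

(** [diag2 A] is the rational representation of an endomorphism of the torus of
    [W] exactly when [A] commutes with [W]. *)
Lemma diag2_period (F : 'M[R[i]]_g) (A : 'M[int]_g) W :
  F *m period W = period W *m map_mx intr (diag2 A) <->
  F = map_mx intr A /\ commuting A W.
Proof.
rewrite /diag2 map_block_mx !map_mx0 /period mul_mx_row mul_row_block mulmx1 !mul1mx.
rewrite !mulmx0 addr0 add0r /commuting; split=> [/eq_row_mx[-> ->] //|[-> ->] //].
Qed.

Lemma moduli_pi_act (Z W : siegel) (S : 'M[int]_(g + g)) : Sp S ->
  val W = Sp_act S (val Z) -> \pi_moduli Z = \pi_moduli W.
Proof. by move=> SpS WE; apply/eqmodP/asboolP; exists S. Qed.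

(** The matrix of the involution is put in normal form by a symplectic change of
    basis, which moves [Z] to another representative of its class. *)
Lemma locus_standard (x : moduli) : involution_locus x ->
  exists (W : siegel) A, [/\ x = \pi_moduli W, standard_involution A & commuting A (val W)].
Proof.
move=> [Z [-> [f [finv fN]]]]; have Zs : siegel (val Z) := set_valP Z.
have [F [M [FM SpM MM M1 MN]]] := involution_rep Zs finv fN.
have [S [A [SpS MS]]] := involution_normal_form SpM MM.
have [T SpT ST] := SpV SpS; have TS := mulmx1C ST.
have DE : diag2 A = T *m M *m S by rewrite -mulmxA MS mulmxA TS mul1mx.
have ME : M = S *m diag2 A *m T by rewrite -MS -mulmxA ST mulmx1.
have [P Pu PW] := Sp_act_period SpS Zs.
have Ws := Sp_act_siegel SpS Zs.
exists (SigSub (mem_set Ws)), A; split.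
- exact: moduli_pi_act SpS _.
- split.
  + by rewrite DE; apply: Sp_mul => //; apply: Sp_mul.
  + apply: diag2_inj; rewrite -diag2M diag2_1 DE -!mulmxA (mulmxA S T) ST mul1mx.
    by rewrite (mulmxA M M) MM mul1mx.
  + by move=> A1; apply: M1; rewrite ME A1 diag2_1 mulmx1.
  + by move=> A1; apply: MN; rewrite ME A1 diag2N diag2_1 mulmxN mulmx1 mulNmx ST.
have /diag2_period[] // : invmx P *m F *m P *m period (Sp_act S (val Z)) =
    period (Sp_act S (val Z)) *m map_mx intr (diag2 A).
rewrite -!mulmxA PW (mulmxA F) FM -mulmxA -map_mxM MS map_mxM (mulmxA (period _)) -PW.
by rewrite -!mulmxA mulKmx.
Qed.

(** The involution is the one induced by [A] on the torus of [W]. *)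
Lemma standard_in_locus (W : siegel) A : standard_involution A -> commuting A (val W) ->
  involution_locus (\pi_moduli W).
Proof.
move=> [SpD AA A1 AN] AW; have Ws : siegel (val W) := set_valP W.
pose F : 'M[R[i]]_g := map_mx intr A.
have FD : F *m period (val W) = period (val W) *m map_mx intr (diag2 A).
  exact/diag2_period.
pose f (x : torus (val W)) : torus (val W) := \pi_(torus (val W)) (F *m repr x).
have fE u : f (\pi_(torus (val W)) u) = \pi_(torus (val W)) (F *m u).
  have /torus_pi_eq[m mE] : \pi_(torus (val W)) (repr (\pi_(torus (val W)) u)) = \pi u.
    by rewrite reprK.
  apply/torus_pi_eq; exists (diag2 A *m m).
  by rewrite -mulmxBr mE mulmxA FD -mulmxA map_mxM.
have ff : f \o f = id.
  apply/funext => x; have [u ->] := torus_surj x.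
  have : f (f (\pi_(torus (val W)) u)) = \pi_(torus (val W)) u.
    by rewrite !fE mulmxA -map_mxM AA map_mx1 mul1mx.
  exact.
have rigid (G : 'M[int]_g) :
    (forall u, f (\pi_(torus (val W)) u) = \pi_(torus (val W)) (map_mx intr G *m u)) -> A = G.
  move=> fG; apply: (@intr_mx_inj R[i]); apply/eqP; rewrite -subr_eq0; apply/eqP.
  apply: (lattice_full_eq0 Ws) => u; rewrite mulmxBl; apply/torus_pi_eq.
  by rewrite -fG fE.
exists W; split=> //; exists f; split; last first.
  move=> fN; apply: AN; apply: rigid => u.
  by rewrite fN torus_oppE map_mxN map_mx1 mulNmx mul1mx.
split=> //; last first.
  by move=> f1; apply: A1; apply: rigid => u; rewrite f1 map_mx1 mul1mx.
split; first by exists f => x; exact: (congr1 (fun h => h x) ff).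
by exists F; split=> //; apply/(polarization_Sp Ws FD).
Qed.

End Locus.

(** * Continuity *)

Lemma continuous_mx (T U : topologicalType) m n (f : T -> 'M[U]_(m, n)) :
  (forall i j, continuous (fun t => f t i j)) -> continuous f.
Proof.
move=> fc t B [P Pnbhs PB].
have : \forall s \near t, forall i j, P i j (f s i j).
  apply: filter_forall => i; apply: filter_forall => j; exact: fc (Pnbhs i j).
by apply: filterS => s /= Ps; apply: PB.
Qed.

Lemma continuous_real_complex (R : realType) : continuous (real_complex R : R -> R[i]).
Proof.
move=> x; apply/cvgrPdist_lt => e e0.
have [r r0 eE] : exists2 r : R, 0 < r & e = r%:C.
  by case: e e0 => a b; rewrite ltcE /= => /andP[/eqP -> a0]; exists a.
have : \forall t \near x, `|x - t| < r by apply: nbhsx_ballx.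
apply: filterS => t xt; rewrite eE -rmorphB /= normc_def /=.
by rewrite expr0n addr0 sqrtr_sqr ltcR.
Qed.

(** * Arcs to a common point *)

Section Arc.
Variables (R : realType) (g : nat).
Local Notation siegel := (@siegel R g).
Local Notation moduli := (moduli R g).

Definition base_point : 'M[R[i]]_g := 'i%:M.

(** The weights are squares so that the arc stays in the Siegel space for every
    real [t]. *)
Definition arc (W : 'M[R[i]]_g) (t : R) : 'M[R[i]]_g :=
  ((1 - t) ^+ 2)%:C *: base_point + (t ^+ 2)%:C *: W.

Lemma base_point_siegel : siegel base_point.
Proof.
split=> [|v v0]; first by rewrite tr_scalar_mx.
have -> : ImM base_point = 1%:M.
  by apply/matrixP => i j; rewrite !mxE; case: eqP.
have [j vj] : exists j, v j 0 != 0.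
  apply: contrapT => /forallNP v00; move/eqP: v0; apply; apply/colP => j.
  by have /negP/negPn/eqP -> := v00 j; rewrite mxE.
rewrite mulmx1 mxE (bigD1 j) //= mxE ltr_pwDl // -?expr2 ?exprn_even_gt0 //.
by apply: sumr_ge0 => k _; rewrite mxE -expr2 sqr_ge0.
Qed.

Lemma arc_siegel W t : siegel W -> siegel (arc W t).
Proof.
have [Isym Ipos] := base_point_siegel; move=> [Wsym Wpos]; split.
  by rewrite /arc linearD !linearZ /= Isym Wsym.
move=> v v0.
have -> : ImM (arc W t) = (1 - t) ^+ 2 *: ImM base_point + t ^+ 2 *: ImM W.
  have ImE (x y : R) (z w : R[i]) :
      complex.Im (x%:C * z + y%:C * w) = x * complex.Im z + y * complex.Im w.
    by case: z w => a b [c d] /=; rewrite !mul0r !addr0.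
  by apply/matrixP => i j; rewrite !mxE ImE.
have addE (a b : R) (B B' : 'M[R]_1) : (a *: B + b *: B') 0 0 = a * B 0 0 + b * B' 0 0.
  by rewrite !mxE.
rewrite mulmxDr mulmxDl -!scalemxAr -!scalemxAl addE.
have [->|t0] := eqVneq t 0.
  by rewrite subr0 expr1n mul1r expr0n mul0r addr0 Ipos.
apply: ltr_wpDl; first by apply: mulr_ge0; [exact: sqr_ge0|apply/ltW/Ipos].
by rewrite mulr_gt0 ?Wpos // exprn_even_gt0.
Qed.

Definition siegel_arc (W : siegel) (t : R) : siegel :=
  SigSub (mem_set (arc_siegel t (set_valP W))).

Lemma siegel_arc_continuous (W : siegel) : continuous (siegel_arc W).
Proof.
apply: continuous_comp_initial; apply: continuous_mx => i j.
rewrite (_ : (fun t => _) =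
  (fun t : R => ((1 - t) ^+ 2)%:C * base_point i j + (t ^+ 2)%:C * val W i j)); last first.
  by apply/funext => t; rewrite /= /arc !mxE.
have c1 : continuous (fun t : R => (t ^+ 2)%:C).
  move=> t; apply: (@continuous_comp _ _ _ (fun t : R => t ^+ 2) (real_complex R)).
    exact: exprn_continuous.
  exact: continuous_real_complex.
have c2 : continuous (fun t : R => ((1 - t) ^+ 2)%:C).
  move=> t; apply: (@continuous_comp _ _ _ (fun t : R => 1 - t) (fun t : R => (t ^+ 2)%:C)).
    by apply: cvgB; [exact: cvg_cst|exact: cvg_id].
  exact: c1.
by move=> t; apply: cvgD; apply: cvgMr_tmp; [exact: c2|exact: c1].
Qed.

Lemma arc_commuting A W t : commuting A W -> commuting A (arc W t).
Proof.
rewrite /commuting /arc /base_point => AW.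
by rewrite mulmxDr mulmxDl -!scalemxAr -!scalemxAl AW scalar_mxC.
Qed.

Lemma arc0 W : arc W 0 = base_point.
Proof. by rewrite /arc subr0 expr1n expr0n scale1r scale0r addr0. Qed.

Lemma arc1 W : arc W 1 = W.
Proof. by rewrite /arc subrr expr1n expr0n scale1r scale0r add0r. Qed.

End Arc.

Theorem mainTheorem1 (R : realType) (g : nat) (hg : (3 <= g)%N) :
  connected (@involution_locus R g).
Proof.
pose P (W : @siegel R g) := exists2 A, standard_involution A & commuting A (val W).
pose C (W : @siegel R g) : set (moduli R g) :=
  (\pi_(moduli R g) \o siegel_arc W) @` setT.
have -> : @involution_locus R g = \bigcup_(W in P) C W.
  apply/seteqP; split=> [x /locus_standard[W [A [-> Astd AW]]]|x [W [A Astd AW] [t _ <-]]].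
    exists W; first by exists A.
    by exists 1 => //=; congr (\pi _); apply: val_inj; rewrite /= arc1.
  apply: standard_in_locus Astd _; exact: arc_commuting.
apply: bigcup_connected => [|W _].
  have [[W0 PW0]|P0] := pselect (exists W, P W); last first.
    (* The locus is empty, and so is the family of arcs: any point will do. *)
    exists (\pi_(moduli R g) (SigSub (mem_set (base_point_siegel R g)))) => W PW.
    by case: P0; exists W.
  exists (\pi_(moduli R g) (siegel_arc W0 0)) => W _; exists 0 => //=; congr (\pi _).
  by apply: val_inj; rewrite /= !arc0.
apply: connected_continuous_connected.
  by apply/connected_intervalP => ? ? ? ? ? ?.
apply: continuous_subspaceT => t.
by apply: continuous_comp; [exact: siegel_arc_continuous|exact: pi_continuous].
Qed.
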